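(* Let $D$ and $V$ be two dendriform algebras, let $E$ be a vector space with $E=D+V$, $D\cap V=\{0\}$, and let $\rho:E\to D$ be the retraction associated to $V$, i.e. $\rho(a+x)=a$ for $a\in D$, $x\in V$. Suppose that $D\subset E$ is an extension of dendriform algebras. Then the following conditions are equivalent: (1) the dendriform algebra $E$ factorizes through $D$ and $V$; (2) the unified product corresponding to the dendriform extending structure $\Omega(D,V)=\Upsilon_1(E)$ is a bicrossed product $D\bowtie V$.
   Context: The base field is $\mathbf{k}=\mathbb{C}$. A dendriform algebra is a vector space $D$ with bilinear operations $\succ,\prec$ such that for all $x,y,z$: $(x\succ y+x\prec y)\succ z=x\succ(y\succ z)$; $(x\prec y)\prec z=x\prec(y\succ z+y\prec z)$; $(x\succ y)\prec z=x\succ(y\prec z)$. ''$D\subset E$ is an extension of dendriform algebras'' means that $E$ carries a dendriform algebra structure $(E,\succ_E,\prec_E)$ of which $D$ is a subalgebra. The dendriform algebra $E$ factorizes through $D$ and $V$ if $E$ contains the dendriform algebras $D$ and $V$ as subalgebras, $E=D+V$ and $D\cap V=\{0\}$. An extending datum of $D$ through $V$ is a system of twelve bilinear maps $\Omega(D,V)=(\triangleright_1,\triangleright_2,\triangleleft_1,\triangleleft_2,\rightharpoonup_1,\rightharpoonup_2,\leftharpoonup_1,\leftharpoonup_2,f_1,f_2,\succ_V,\prec_V)$ with $\triangleright_i:D\times V\to V$, $\triangleleft_i:V\times D\to V$, $\rightharpoonup_i:V\times D\to D$, $\leftharpoonup_i:D\times V\to D$, $f_i:V\times V\to D$, $\succ_V,\prec_V:V\times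 V\to V$. It is a dendriform extending structure if $D\times V$ with $(a,x)\succeq(b,y):=(a\succ b+a\leftharpoonup_1 y+x\rightharpoonup_1 b+f_1(x,y),\ a\triangleright_1 y+x\triangleleft_1 b+x\succ_V y)$ and $(a,x)\preceq(b,y):=(a\prec b+a\leftharpoonup_2 y+x\rightharpoonup_2 b+f_2(x,y),\ a\triangleright_2 y+x\triangleleft_2 b+x\prec_V y)$ is a dendriform algebra, which is then called the unified product $D\natural V$. $\Upsilon_1(E)$ is the dendriform extending structure defined, for $a\in D$, $x,y\in V$, by $a\triangleright_1x:=a\succ_Ex-\rho(a\succ_Ex)$, $x\triangleleft_1a:=x\succ_Ea-\rho(x\succ_Ea)$, $a\leftharpoonup_1x:=\rho(a\succ_Ex)$, $x\rightharpoonup_1a:=\rho(x\succ_Ea)$, $f_1(x,y):=\rho(x\succ_Ey)$, $x\succ_Vy:=x\succ_Ey-\rho(x\succ_Ey)$, and $\triangleright_2,\triangleleft_2,\leftharpoonup_2,\rightharpoonup_2,f_2,\prec_V$ by the same formulas with $\prec_E$ in place of $\succ_E$. The unified product of a dendriform extending structure $\Omega(D,V)$ is a bicrossed product $D\bowtie V$ of the dendriform algebras $D$ and $V$ if $f_1=f_2=0$ and the components $\succ_V,\prec_V$ of $\Omega(D,V)$ are the operations of the dendriform algebra $V$ (so that $D$, $V$ and the eight action maps form a matched pair of dendriform algebras). *)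

(* Defs.v *)
From HB Require Import structures.
From mathcomp Require Import all_boot all_order all_algebra.

Set Implicit Arguments.
Unset Strict Implicit.
Unset Printing Implicit Defensive.

Import GRing.Theory.
Local Open Scope ring_scope.

Section Dendriform.
Variables (K : fieldType) (M : lmodType K).

Definition dendriform_axioms (s p : M -> M -> M) : Prop :=
  [/\ forall x y z, s (s x y + p x y) z = s x (s y z),
      forall x y z, p (p x y) z = p x (s y z + p y z)
    & forall x y z, p (s x y) z = s x (p y z)].

Record dendriform := Dendriform {
  dsucc : {bilinear M -> M -> M};
  dprec : {bilinear M -> M -> M};
  dendriformP : dendriform_axioms dsucc dprec }.

End Dendriform.

(* A subspace of [E] is a type [S : subLmodType P], whose
    elements are those of the linear subset [P] of [E] and whose inclusion
    into [E] is [\val]. *)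

Section Subspaces.
Variables (K : fieldType) (E : lmodType K).

Definition is_subalgebra (P : pred E) (S : subLmodType P)
    (dS : dendriform S) (dE : dendriform E) : Prop :=
  (forall x y : S, \val (dsucc dS x y) = dsucc dE (\val x) (\val y)) /\
  (forall x y : S, \val (dprec dS x y) = dprec dE (\val x) (\val y)).

Variables (PD PV : pred E) (D : subLmodType PD) (V : subLmodType PV).

Definition direct_decomposition : Prop :=
  (forall e : E, exists (a : D) (x : V), e = \val a + \val x) /\
  (forall e : E, e \in PD -> e \in PV -> e = 0).

Definition factorizes (dE : dendriform E) (dD : dendriform D)
    (dV : dendriform V) : Prop :=
  [/\ is_subalgebra dD dE, is_subalgebra dV dE & direct_decomposition].

Definition is_retraction (rho : E -> D) : Prop :=
  forall (a : D) (x : V), rho (\val a + \val x) = a.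

End Subspaces.

Arguments direct_decomposition {K E PD PV} D V.
Arguments is_retraction {K E PD PV D} V rho.

Section Extending.
Variables (K : fieldType) (D V : lmodType K).

(* [rt], [lt], [rh], [lh] stand for the triangles pointing right and left and
   for the harpoons pointing right and left. *)
Record extending_datum := ExtendingDatum {
  rt1 : {bilinear D -> V -> V};
  rt2 : {bilinear D -> V -> V};
  lt1 : {bilinear V -> D -> V};
  lt2 : {bilinear V -> D -> V};
  rh1 : {bilinear V -> D -> D};
  rh2 : {bilinear V -> D -> D};
  lh1 : {bilinear D -> V -> D};
  lh2 : {bilinear D -> V -> D};
  f1 : {bilinear V -> V -> D};
  f2 : {bilinear V -> V -> D};
  succV : {bilinear V -> V -> V};
  precV : {bilinear V -> V -> V} }.

Variable dD : dendriform D.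

Definition unified_succ (O : extending_datum) (u v : D * V) : D * V :=
  (dsucc dD u.1 v.1 + lh1 O u.1 v.2 + rh1 O u.2 v.1 + f1 O u.2 v.2,
   rt1 O u.1 v.2 + lt1 O u.2 v.1 + succV O u.2 v.2).

Definition unified_prec (O : extending_datum) (u v : D * V) : D * V :=
  (dprec dD u.1 v.1 + lh2 O u.1 v.2 + rh2 O u.2 v.1 + f2 O u.2 v.2,
   rt2 O u.1 v.2 + lt2 O u.2 v.1 + precV O u.2 v.2).

Record extending_structure := ExtendingStructure {
  ext_datum :> extending_datum;
  ext_axioms : dendriform_axioms (unified_succ ext_datum)
                                 (unified_prec ext_datum) }.

Lemma add4ACA (W : lmodType K) (a b c d a' b' c' d' : W) :
  a + a' + (b + b') + (c + c') + (d + d') =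
  a + b + c + d + (a' + b' + c' + d').
Proof. by rewrite [LHS](AC (2*2*2*2) (1*3*5*7*(2*4*6*8)))%AC. Qed.

Lemma add3ACA (W : lmodType K) (a b c a' b' c' : W) :
  a + a' + (b + b') + (c + c') = a + b + c + (a' + b' + c').
Proof. by rewrite [LHS](AC (2*2*2) (1*3*5*(2*4*6)))%AC. Qed.

Fact unified_succ_bilinear (O : extending_datum) :
  bilinear_for *:%R *:%R (unified_succ O).
Proof.
split=> [[b y] k [a x] [a' x']|[b y] k [a x] [a' x']];
by congr pair; rewrite /= ?linearPl ?linearPr /= ?scalerDr ?add4ACA ?add3ACA.
Qed.

Fact unified_prec_bilinear (O : extending_datum) :
  bilinear_for *:%R *:%R (unified_prec O).
Proof.
split=> [[b y] k [a x] [a' x']|[b y] k [a x] [a' x']];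
by congr pair; rewrite /= ?linearPl ?linearPr /= ?scalerDr ?add4ACA ?add3ACA.
Qed.

HB.instance Definition _ (O : extending_datum) :=
  bilinear_isBilinear.Build K (D * V)%type (D * V)%type (D * V)%type
    *:%R *:%R (unified_succ O) (unified_succ_bilinear O).
HB.instance Definition _ (O : extending_datum) :=
  bilinear_isBilinear.Build K (D * V)%type (D * V)%type (D * V)%type
    *:%R *:%R (unified_prec O) (unified_prec_bilinear O).

Definition unified_product (O : extending_structure) : dendriform (D * V)%type :=
  @Dendriform K (D * V)%type (unified_succ O) (unified_prec O) (ext_axioms O).

Definition is_bicrossed (dV : dendriform V) (O : extending_structure) : Prop :=
  [/\ forall x y, f1 O x y = 0,
      forall x y, f2 O x y = 0,
      forall x y, succV O x y = dsucc dV x y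
    & forall x y, precV O x y = dprec dV x y].

End Extending.

Section Restrict.
Variables (K : fieldType) (E A B C : lmodType K).
Variables (p : {linear E -> C}) (m : {bilinear E -> E -> E}).
Variables (i : {linear A -> E}) (j : {linear B -> E}).

Definition restrict (a : A) (b : B) : C := p (m (i a) (j b)).

Fact restrict_bilinear : bilinear_for *:%R *:%R restrict.
Proof.
by split=> b k a a'; rewrite /restrict linearP ?linearPl ?linearPr /= linearP.
Qed.

HB.instance Definition _ :=
  bilinear_isBilinear.Build K A B C *:%R *:%R restrict restrict_bilinear.

End Restrict.

Section Upsilon.
Variables (K : fieldType) (E : lmodType K) (PD PV : pred E).
Variables (D : subLmodType PD) (V : subLmodType PV).
Variables (dD : dendriform D) (dE : dendriform E) (rho : E -> D).
Hypothesis hDV : direct_decomposition D V.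
Hypothesis hrho : is_retraction V rho.
Hypothesis hD : is_subalgebra dD dE.

Fact retraction_linear : linear rho.
Proof.
move=> k e e'.
have [a [x ->]] := hDV.1 e; have [a' [x' ->]] := hDV.1 e'.
by rewrite scalerDr addrACA -!linearP !hrho.
Qed.

Definition retr : {linear E -> D} :=
  HB.pack rho (GRing.isLinear.Build K E D *:%R rho retraction_linear).

Fact compl_subproof (e : E) : PV (e - \val (rho e)).
Proof.
have [a [x ->]] := hDV.1 e; rewrite hrho addrAC subrr add0r.
exact: (valP x).
Qed.

Definition compl_fun (e : E) : V := Sub (e - \val (rho e)) (compl_subproof e).

Fact compl_linear : linear compl_fun.
Proof.
move=> k e e'; apply: val_inj.
rewrite linearP /= !SubK retraction_linear linearP /=.
by rewrite scalerBr opprD addrACA.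
Qed.

Definition compl : {linear E -> V} :=
  HB.pack compl_fun (GRing.isLinear.Build K E V *:%R compl_fun compl_linear).

(* [restrict compl (dsucc dE) iD iV a x] is [a >-_E x - rho (a >-_E x)] and
   [restrict retr (dsucc dE) iD iV a x] is [rho (a >-_E x)]. *)
Let iD : {linear D -> E} := \val.
Let iV : {linear V -> E} := \val.

Definition Upsilon1_datum : extending_datum D V := {|
  rt1 := restrict compl (dsucc dE) iD iV;
  rt2 := restrict compl (dprec dE) iD iV;
  lt1 := restrict compl (dsucc dE) iV iD;
  lt2 := restrict compl (dprec dE) iV iD;
  rh1 := restrict retr (dsucc dE) iV iD;
  rh2 := restrict retr (dprec dE) iV iD;
  lh1 := restrict retr (dsucc dE) iD iV;
  lh2 := restrict retr (dprec dE) iD iV;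
  f1 := restrict retr (dsucc dE) iV iV;
  f2 := restrict retr (dprec dE) iV iV;
  succV := restrict compl (dsucc dE) iV iV;
  precV := restrict compl (dprec dE) iV iV |}.

Let phi (u : D * V) : E := \val u.1 + \val u.2.

Let phi_inj : injective phi.
Proof.
move=> [a x] [b y]; rewrite /phi /= => e.
have ab : a = b by rewrite -(hrho a x) e hrho.
by move: e; rewrite ab => /addrI /val_inj ->.
Qed.

Let phiD u v : phi (u + v) = phi u + phi v.
Proof. by rewrite /phi /= !linearD /= addrACA. Qed.

Let phiE (e : E) : \val (rho e) + \val (compl_fun e) = e.
Proof. by rewrite SubK addrC subrK. Qed.

Let phi_mul (s : {bilinear D -> D -> D}) (m : {bilinear E -> E -> E})
    (hs : forall x y : D, \val (s x y) = m (\val x) (\val y)) (u v : D * V) :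
  phi (s u.1 v.1 + restrict retr m iD iV u.1 v.2 + restrict retr m iV iD u.2 v.1
         + restrict retr m iV iV u.2 v.2,
       restrict compl m iD iV u.1 v.2 + restrict compl m iV iD u.2 v.1
         + restrict compl m iV iV u.2 v.2) = m (phi u) (phi v).
Proof.
case: u v => [a x] [b y].
rewrite /phi /restrict /= !(linearD (\val : D -> E)) !(linearD (\val : V -> E)).
rewrite /= hs linearDl !linearDr /=.
by rewrite [LHS](AC (4*3) (1*(2*5)*((3*6)*(4*7))))%AC /= !phiE.
Qed.

Fact Upsilon1_axioms :
  dendriform_axioms (unified_succ dD Upsilon1_datum)
                    (unified_prec dD Upsilon1_datum).
Proof.
have hs u v : phi (unified_succ dD Upsilon1_datum u v)
              = dsucc dE (phi u) (phi v) := phi_mul hD.1 u v.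
have hp u v : phi (unified_prec dD Upsilon1_datum u v)
              = dprec dE (phi u) (phi v) := phi_mul hD.2 u v.
have [h1 h2 h3] := dendriformP dE.
split=> u v w; apply: phi_inj; rewrite !(hs, hp, phiD);
[exact: h1 | exact: h2 | exact: h3].
Qed.

Definition Upsilon1 : extending_structure V dD :=
  ExtendingStructure Upsilon1_axioms.

End Upsilon.

(* Main.v *)
Require Import Defs.
From mathcomp Require Import all_boot all_order all_algebra.
From mathcomp Require Import reals complex.
Import GRing.Theory.
Local Open Scope ring_scope.

(** Every [e] in [E] is [rho e + (e - rho e)], the unique decomposition of [e]
    along [D] and [V].  For [x], [y] in [V], the maps [f1] and [succV] of
    [Upsilon1] are exactly the two components of [dsucc dE x y], and likewise
    [f2] and [precV] for [dprec].  Hence [f1 = f2 = 0] together with the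
    agreement of [succV], [precV] with the operations of [V] says that the
    products in [E] of elements of [V] are their products in [V], that is, that
    [V] is a subalgebra of [E] (lemma [eq_val_components]).  The other
    requirements of a factorization, that [D] is a subalgebra and that [E] is
    the direct sum of [D] and [V], are among the hypotheses. *)

Section Components.
Context {K : fieldType} {E : lmodType K} {PD PV : pred E}.
Context {D : subLmodType PD} {V : subLmodType PV} {rho : E -> D}.
Hypotheses (hDV : direct_decomposition D V) (hrho : is_retraction V rho).

Lemma retraction_val (x : V) : rho (\val x) = 0.
Proof. by rewrite -[\val x]add0r -(linear0 (\val : {linear D -> E})) hrho. Qed.

(** Components along a direct decomposition are unique.  Taking for [e] a product
    in [E] of two elements of [V], this splits the subalgebra condition on [V]
    into a condition in [D] and one in [V]. *)
Lemma eq_val_components (e : E) (x : V) :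
  e = \val x <-> rho e = 0 /\ compl_fun hDV hrho e = x.
Proof.
split=> [-> | [rho0 <-]]; last by rewrite SubK rho0 linear0 subr0.
split; first exact: retraction_val.
by apply: val_inj; rewrite SubK retraction_val linear0 subr0.
Qed.

End Components.

Theorem proposition4p6 (R : realType) (E : lmodType R[i]) (PD PV : pred E)
    (D : subLmodType PD) (V : subLmodType PV)
    (dD : dendriform D) (dV : dendriform V)
    (hDV : direct_decomposition D V)
    (rho : E -> D) (hrho : is_retraction V rho)
    (dE : dendriform E) (hD : is_subalgebra dD dE) :
  factorizes dE dD dV <-> is_bicrossed dV (Upsilon1 hDV hrho hD).
Proof.
split=> [[_ [hs hp] _] | [f10 f20 sV pV]].
  by split=> x y; have /esym/(eq_val_components hDV hrho)[] := hs x y;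
     have /esym/(eq_val_components hDV hrho)[] := hp x y.
split=> //; split=> x y; apply/esym/(eq_val_components hDV hrho); split.
- exact: f10.
- exact: sV.
- exact: f20.
- exact: pV.
Qed.
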